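(* Let $\mathcal V$ be a variety. The following identities are equivalent within $\mathcal V$ (each being required to hold in every algebra of $\mathcal V$ for all relations of the kind specified below), and each of them holds in $\mathcal V$ if and only if it holds in $\mathbf F_{\mathcal V}(3)$. (1) $\sigma(\tau\circ\upsilon)\subseteq(\sigma\tau\circ\sigma\upsilon)^{\circledast}$; equivalently, $(\sigma(\tau\circ\upsilon))^{\circledast}=(\sigma\tau\circ\sigma\upsilon)^{\circledast}$. (2) $\sigma(\tau\circ\tau)\subseteq(\sigma\tau)^{\circledast}$; equivalently, $(\sigma(\tau\circ\tau))^{\circledast}=(\sigma\tau)^{\circledast}$. (3) $\sigma^{\circledast}\tau^{\circledast}=(\sigma\tau)^{\circledast}$; equivalently, $(\sigma^{\circledast}\tau^{\circledast})^{\circledast}=(\sigma\tau)^{\circledast}$. In these identities $\sigma,\tau,\upsilon$ range over U-admissible relations or, equivalently, over U$_2$-admissible relations. Limited to item (1), one can equivalently let them range over reflexive and admissible relations.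
   Context: Juxtaposition denotes intersection and binds more tightly than $\circ$; exponents bind more tightly than everything else (so $\sigma^{\circledast}\tau^{\circledast}=(\sigma^{\circledast})\cap(\tau^{\circledast})$ and $\sigma\tau\circ\sigma\upsilon=(\sigma\cap\tau)\circ(\sigma\cap\upsilon)$). $\circ$ is relational composition and $R^{\circledast}$ is the transitive closure of $R$. A binary relation on an algebra $\mathbf A$ is admissible if it is compatible with all operations. A relation is U-admissible if it is the set-theoretical union of some nonempty set of reflexive and admissible relations on $\mathbf A$; it is U$_2$-admissible if it is the union of two reflexive and admissible relations. $\mathbf F_{\mathcal V}(3)$ is the free algebra in $\mathcal V$ generated by 3 elements. Inclusions are also called identities, since $A\subseteq B$ is equivalent to $A=A\cap B$. *)

(* Defs.v *)
From mathcomp Require Import all_boot boolp.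
From Stdlib Require Import List Relations.

Set Implicit Arguments.
Unset Strict Implicit.
Unset Printing Implicit Defensive.

Declare Scope brel_scope.
Delimit Scope brel_scope with brel.

Definition rmeet (T : Type) (R S : relation T) : relation T :=
  fun x y => R x y /\ S x y.

Definition rcomp (T : Type) (R S : relation T) : relation T :=
  fun x z => exists y, R x y /\ S y z.

Notation "R ⊓ S" := (rmeet R S) (at level 40, left associativity) : brel_scope.
Notation "R ∘ S" := (rcomp R S) (at level 45, left associativity) : brel_scope.
Notation "R ^⊛" := (clos_trans _ R) (at level 2, left associativity, format "R ^⊛")
  : brel_scope.
Notation "R ⊆ S" := (inclusion _ R S) (at level 70, no associativity) : brel_scope.
Notation "R ≡ S" := (same_relation _ R S) (at level 70, no associativity) : brel_scope.

Record signature : Type := Signature {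
  op_symbol : Type;
  arity : op_symbol -> nat
}.

Record algebra (S : signature) : Type := Algebra {
  carrier :> Type;
  interp : forall f : op_symbol S, ('I_(arity f) -> carrier) -> carrier;
  carrier_inhabited : inhabited carrier
}.

Inductive term (S : signature) (X : Type) : Type :=
| Var (x : X)
| App (f : op_symbol S) (ts : 'I_(arity f) -> term S X).
Arguments Var {S X} x.
Arguments App {S X} f ts.

Fixpoint eval (S : signature) (X : Type) (A : algebra S) (v : X -> A)
    (t : term S X) : A :=
  match t with
  | Var x => v x
  | App f ts => @interp S A f (fun i => eval v (ts i))
  end.

Definition satisfies (S : signature) (X : Type) (A : algebra S) (s t : term S X) : Prop :=
  forall v : X -> A, eval v s = eval v t.

Definition is_variety (S : signature) (V : algebra S -> Prop) : Prop :=
  exists E : term S nat -> term S nat -> Prop,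
    forall A : algebra S, V A <-> forall s t, E s t -> satisfies A s t.

Definition is_hom (S : signature) (A B : algebra S) (h : A -> B) : Prop :=
  forall (f : op_symbol S) (a : 'I_(arity f) -> A),
    h (@interp S A f a) = @interp S B f (fun i => h (a i)).

(* The generators [x i] need not be distinct: they all coincide when every
   member of [V] is trivial. *)
Definition is_free (S : signature) (V : algebra S -> Prop) (X : Type) (F : algebra S)
    (x : X -> F) : Prop :=
  V F /\
  forall (B : algebra S) (b : X -> B), V B ->
    exists h : F -> B,
      (is_hom h /\ forall i, h (x i) = b i) /\
      forall h' : F -> B, is_hom h' -> (forall i, h' (x i) = b i) ->
        forall a, h' a = h a.

Definition admissible (S : signature) (A : algebra S) (R : relation A) : Prop :=
  forall (f : op_symbol S) (a b : 'I_(arity f) -> A),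
    (forall i, R (a i) (b i)) -> R (@interp S A f a) (@interp S A f b).

Definition relation_kind (S : signature) : Type :=
  forall A : algebra S, relation A -> Prop.

Definition refl_admissible (S : signature) : relation_kind S :=
  fun A R => reflexive A R /\ admissible R.

Definition U_admissible (S : signature) : relation_kind S :=
  fun A R => exists P : relation A -> Prop,
    (exists Q, P Q) /\
    (forall Q, P Q -> refl_admissible Q) /\
    (forall x y, R x y <-> exists Q, P Q /\ Q x y).

Definition U2_admissible (S : signature) : relation_kind S :=
  fun A R => exists Q1 Q2 : relation A,
    refl_admissible Q1 /\ refl_admissible Q2 /\
    (forall x y, R x y <-> Q1 x y \/ Q2 x y).

Definition condition (S : signature) : Type := algebra S -> Prop.

Definition valid_in (S : signature) (V : algebra S -> Prop) (c : condition S) : Prop :=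
  forall A : algebra S, V A -> c A.

Section Identities.
Local Open Scope brel_scope.
Variables (S : signature) (K : relation_kind S).

Definition id1_incl : condition S := fun A =>
  forall σ τ υ : relation A, K σ -> K τ -> K υ ->
    σ ⊓ (τ ∘ υ) ⊆ (σ ⊓ τ ∘ σ ⊓ υ)^⊛.

Definition id1_eq : condition S := fun A =>
  forall σ τ υ : relation A, K σ -> K τ -> K υ ->
    (σ ⊓ (τ ∘ υ))^⊛ ≡ (σ ⊓ τ ∘ σ ⊓ υ)^⊛.

Definition id2_incl : condition S := fun A =>
  forall σ τ : relation A, K σ -> K τ -> σ ⊓ (τ ∘ τ) ⊆ (σ ⊓ τ)^⊛.

Definition id2_eq : condition S := fun A =>
  forall σ τ : relation A, K σ -> K τ -> (σ ⊓ (τ ∘ τ))^⊛ ≡ (σ ⊓ τ)^⊛.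

Definition id3_eq : condition S := fun A =>
  forall σ τ : relation A, K σ -> K τ -> σ^⊛ ⊓ τ^⊛ ≡ (σ ⊓ τ)^⊛.

Definition id3_eq_closed : condition S := fun A =>
  forall σ τ : relation A, K σ -> K τ -> (σ^⊛ ⊓ τ^⊛)^⊛ ≡ (σ ⊓ τ)^⊛.

End Identities.

Definition all_conditions (S : signature) : list (condition S) :=
  let U := @U_admissible S in
  let U2 := @U2_admissible S in
  let RA := @refl_admissible S in
  [:: id1_incl U;  id1_eq U;  id2_incl U;  id2_eq U;  id3_eq U;  id3_eq_closed U;
      id1_incl U2; id1_eq U2; id2_incl U2; id2_eq U2; id3_eq U2; id3_eq_closed U2;
      id1_incl RA; id1_eq RA].

(* Existence of free algebras: terms modulo the identities valid in [V]. *)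
Section FreeAlgebra.
Variables (S : signature) (V : algebra S -> Prop) (X : Type) (x0 : X).

Definition teq (s t : term S X) : Prop := forall A, V A -> satisfies A s t.

Definition tclass : Type := {P : term S X -> Prop | exists t, P = teq t}.

Definition tpi (t : term S X) : tclass := exist _ (teq t) (ex_intro _ t erefl).

Definition trepr (c : tclass) : term S X := projT1 (cid (proj2_sig c)).

Lemma trepr_K (c : tclass) : tpi (trepr c) = c.
Proof.
rewrite /trepr; case: c => P eP /=; case: cid => t /= eqP_.
by apply: eq_exist => /=; rewrite eqP_.
Qed.

Lemma tpi_eq (s t : term S X) : tpi s = tpi t <-> teq s t.
Proof.
split=> [[e]|e]; first by rewrite e => A _ v.
apply: eq_exist => /=; apply/funext => u; apply/propext.
by split=> h A VA v; [rewrite -(e A VA v) | rewrite (e A VA v)]; apply: h.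
Qed.

Lemma teq_repr (t : term S X) : teq (trepr (tpi t)) t.
Proof. by apply/tpi_eq; rewrite trepr_K. Qed.

Definition free_algebra : algebra S :=
  @Algebra S tclass (fun f c => tpi (App f (fun i => trepr (c i))))
    (inhabits (tpi (Var x0))).

Lemma eval_free (Y : Type) (v : Y -> free_algebra) (t : term S Y) (A : algebra S)
    (w : X -> A) : V A ->
  eval w (trepr (eval v t)) = eval (fun y => eval w (trepr (v y))) t.
Proof.
move=> VA; elim: t => [y|f ts IH] //=.
rewrite (teq_repr _ VA w) /=; congr (interp _).
by apply/funext => i; apply: IH.
Qed.

Lemma free_algebraP : is_variety V ->
  is_free V (F := free_algebra) (fun x => tpi (Var x)).
Proof.
move=> [E VE]; split.
  apply/VE => s t Est v; rewrite -[LHS]trepr_K -[RHS]trepr_K; apply/tpi_eq.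
  by move=> A VA w; rewrite !eval_free //; apply: (VE A).1.
move=> B b VB; exists (fun c => eval b (trepr c)); split; first split.
- by move=> f c; rewrite (teq_repr _ VB b).
- by move=> i; rewrite (teq_repr _ VB b).
move=> h hh hb c; rewrite -[in LHS](trepr_K c).
elim: (trepr c) => [x|f ts IH] /=; first exact: hb.
have -> : tpi (App f ts) = @interp S free_algebra f (fun i => tpi (ts i)).
  apply/tpi_eq => A VA w /=; congr (interp _).
  by apply/funext => i; rewrite (teq_repr _ VA w).
by rewrite hh; congr (interp _); apply/funext => i; apply: IH.
Qed.

End FreeAlgebra.

(* Main.v *)
Require Import Defs.
From mathcomp Require Import all_boot.
From Stdlib Require Import List Relations.

(** Every one of the fourteen conditions is equivalent, in each single algebra,
    to the weakest of them: identity (1) for reflexive admissible relations.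

    Passing from reflexive admissible to U-admissible relations costs nothing in
    (1), since the left side of (1) involves only one pair from each of the three
    relations, so that each relation may be replaced by one reflexive admissible
    relation contained in it ([id1_incl_localize]).  What is gained is that
    (1) becomes strong enough to be iterated: a pair in the transitive closure of
    [τ] lies in a composition of finitely many copies of [τ], which is again
    U-admissible, and (1) splits this composition step by step, whatever
    U-admissible relation it is intersected with.  Doing this to [τ] and then to
    [σ] yields (3) ([id1_U_id3]).  Next, (3) contains (2), because
    [τ ∘ τ ⊆ τ^⊛].  Finally, (2) for U2-admissible relations returns
    (1) for reflexive admissible [τ] and [υ]: apply it to the union of [τ] and
    [υ], whose square contains [τ ∘ υ] ([id2_U2_id1]).

    To go from the free algebra to an arbitrary algebra of the variety, note that
    a failure of (1) involves just three elements [a], [b], [c].  The relations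
    are pulled back along the homomorphism sending the generators to [a], [b],
    [c]; preimages of reflexive admissible relations are of the same kind, and
    the chain found in the free algebra is mapped forward ([id1_transfer]). *)

Set Implicit Arguments.
Unset Strict Implicit.
Unset Printing Implicit Defensive.

Local Open Scope brel_scope.

(** * Transitive closures *)

Section TransitiveClosure.
Variable T : Type.
Implicit Types R Q : relation T.

Lemma clos_trans_least R Q : R ⊆ Q^⊛ -> R^⊛ ⊆ Q^⊛.
Proof.
move=> RQ a b; elim=> {a b} [a b /RQ //|a b c _ ab _ bc].
exact: t_trans ab bc.
Qed.

Lemma clos_trans_mono R Q : R ⊆ Q -> R^⊛ ⊆ Q^⊛.
Proof. by move=> RQ; apply: clos_trans_least => a b /RQ; apply: t_step. Qed.

Lemma rcomp_clos_trans R1 R2 Q :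
  R1 ⊆ Q^⊛ -> R2 ⊆ Q^⊛ -> R1 ∘ R2 ⊆ Q^⊛.
Proof. by move=> R1Q R2Q a c [b [/R1Q ab /R2Q]]; apply: t_trans ab. Qed.

End TransitiveClosure.

Lemma clos_trans_image (T U : Type) (h : T -> U) (R : relation T) (Q : relation U) :
  (forall a b, R a b -> Q (h a) (h b)) ->
  forall a b, R^⊛ a b -> Q^⊛ (h a) (h b).
Proof.
move=> RQ a b; elim=> {a b} [a b /RQ|a b c _ ab _]; first exact: t_step.
exact: t_trans ab.
Qed.

(** * U-admissible relations *)

Section Kinds.
Variables (S : signature) (A : algebra S).
Implicit Types R Q : relation A.

Lemma refl_admissible_U2 R : refl_admissible R -> U2_admissible R.
Proof. by move=> RA; exists R, R; do 2!split=> //; move=> a b; tauto. Qed.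

Lemma U2_admissible_U R : U2_admissible R -> U_admissible R.
Proof.
move=> [Q1 [Q2 [Q1A [Q2A RE]]]]; exists (fun Q => Q = Q1 \/ Q = Q2).
split; [by exists Q1; left | split=> [Q [->|->] //|a b]].
split=> [/RE [ab|ab]|[Q [[->|->] ab]]]; last 2 first.
- by apply/RE; left.
- by apply/RE; right.
- by exists Q1; split=> //; left.
- by exists Q2; split=> //; right.
Qed.

Lemma refl_admissible_comp R Q :
  refl_admissible R -> refl_admissible Q -> refl_admissible (R ∘ Q).
Proof.
move=> [Rr Ra] [Qr Qa]; split=> [a|f a c ac]; first by exists a.
have [b bP] := boolp.choice ac.
by exists (interp b); split; [apply: Ra|apply: Qa] => i; case: (bP i).
Qed.

(** Composition distributes over arbitrary unions, which is why, unlike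
    U2-admissibility, U-admissibility survives iterated composition. *)
Lemma U_admissible_comp R Q :
  U_admissible R -> U_admissible Q -> U_admissible (R ∘ Q).
Proof.
move=> [P [[R0 PR0] [PA RE]]] [P' [[Q0 PQ0] [PA' QE]]].
exists (fun W => exists R1 Q1, [/\ P R1, P' Q1 & W = R1 ∘ Q1]); split.
  by exists (R0 ∘ Q0), R0, Q0.
split=> [_ [R1 [Q1 [PR1 PQ1 ->]]]|a c].
  by apply: refl_admissible_comp; [apply: PA|apply: PA'].
split=> [[b [/RE [R1 [PR1 ab]] /QE [Q1 [PQ1 bc]]]]|].
  by exists (R1 ∘ Q1); split; [exists R1, Q1|exists b].
move=> [_ [[R1 [Q1 [PR1 PQ1 ->]]] [b [ab bc]]]].
by exists b; split; [apply/RE; exists R1|apply/QE; exists Q1].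
Qed.

Lemma U_admissible_refl R : U_admissible R -> reflexive A R.
Proof.
move=> [P [[Q PQ] [PA RE]]] a; apply/RE; exists Q; split=> //.
exact: (PA Q PQ).1.
Qed.

Lemma U_admissible_local R a b :
  U_admissible R -> R a b -> exists Q, [/\ refl_admissible Q, Q ⊆ R & Q a b].
Proof.
move=> [P [_ [PA RE]]] /RE [Q [PQ ab]]; exists Q; split=> //; first exact: PA.
by move=> c d cd; apply/RE; exists Q.
Qed.

Lemma refl_admissible_preim (F : algebra S) (h : F -> A) R :
  is_hom h -> refl_admissible R -> refl_admissible (fun u v => R (h u) (h v)).
Proof. by move=> hh [Rr Ra]; split=> [u|f u v uv]; rewrite ?hh //; apply: Ra. Qed.

End Kinds.

(** * The identities within one algebra *)

Section OneAlgebra.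
Variables (S : signature) (A : algebra S).

Lemma id1_incl_localize : id1_incl (@refl_admissible S) A -> id1_incl (@U_admissible S) A.
Proof.
move=> id1 σ τ υ σU τU υU a c [ac [b [ab bc]]].
have [σ' [σA σs ac']] := U_admissible_local σU ac.
have [τ' [τA τs ab']] := U_admissible_local τU ab.
have [υ' [υA υs bc']] := U_admissible_local υU bc.
have : (σ' ⊓ τ' ∘ σ' ⊓ υ')^⊛ a c.
  by apply: id1 => //; split=> //; exists b.
apply: clos_trans_mono => {ac ab bc ac' ab' bc'} {}a {}c [{}b [[? ?] [? ?]]].
by exists b; split; split; auto.
Qed.

(** Finitely many copies of [τ] composed together serve as [τ'].  Quantifying
    over every [σ] in the conclusion is what lets the induction split a composition
    of two such relations by a single use of identity (1). *)
Lemma clos_trans_absorb (τ : relation A) a b :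
  id1_incl (@U_admissible S) A -> U_admissible τ -> τ^⊛ a b ->
  exists τ', [/\ U_admissible τ', τ' a b &
    forall σ : relation A, U_admissible σ -> σ ⊓ τ' ⊆ (σ ⊓ τ)^⊛].
Proof.
move=> id1 τU; elim=> {a b} [a b ab|a b c _ [τ1 [U1 ab s1]] _ [τ2 [U2 bc s2]]].
  by exists τ; split=> // σ _ c d; apply: t_step.
exists (τ1 ∘ τ2); split; [exact: U_admissible_comp | by exists b | ].
move=> σ σU u v /(id1 _ _ _ σU U1 U2); apply: clos_trans_least.
by apply: rcomp_clos_trans; [apply: s1|apply: s2].
Qed.

Lemma id1_U_id3 : id1_incl (@U_admissible S) A -> id3_eq (@U_admissible S) A.
Proof.
move=> id1 σ τ σU τU; split=> a b.
  move=> [/(clos_trans_absorb id1 σU) [σ' [σ'U σab σs]]].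
  move=> /(clos_trans_absorb id1 τU) [τ' [_ τab τs]].
  have : (σ' ⊓ τ)^⊛ a b by apply: τs.
  apply: clos_trans_least => u v [uv uv'].
  have : (τ ⊓ σ)^⊛ u v by apply: σs.
  by apply: clos_trans_mono => ? ? [].
by move=> ab; split; move: ab; apply: clos_trans_mono => ? ? [].
Qed.

Lemma id2_U2_id1 : id2_incl (@U2_admissible S) A -> id1_incl (@refl_admissible S) A.
Proof.
move=> id2 σ τ υ σA τA υA a c [ac [b [ab bc]]].
have ρU : U2_admissible (fun u v => τ u v \/ υ u v) by exists τ, υ.
have : (σ ⊓ (fun u v => τ u v \/ υ u v))^⊛ a c.
  apply: id2 ρU _ _ _; first exact: refl_admissible_U2.
  by split=> //; exists b; split; [left|right].
(* A step in [τ] or in [υ] alone is completed to a composition by a loop. *)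
apply: clos_trans_mono => u v [uv [uv'|uv']]; [exists v|exists u].
  by do !split=> //; [apply: σA.1|apply: υA.1].
by do !split=> //; [apply: σA.1|apply: τA.1].
Qed.

(** ** Each identity against its variants *)

Section OneKind.
Variable K : relation_kind S.
Hypothesis KU : forall R : relation A, K R -> U_admissible R.

Let K_refl (R : relation A) (KR : K R) : reflexive A R := U_admissible_refl (KU KR).

Lemma id1_incl_eq : id1_incl K A <-> id1_eq K A.
Proof.
split=> id1 σ τ υ Kσ Kτ Kυ.
  split; first by apply: clos_trans_least; apply: id1.
  apply: clos_trans_least; apply: rcomp_clos_trans => a b [ab ab']; apply: t_step.
    by split=> //; exists b; split=> //; apply: K_refl.
  by split=> //; exists a; split=> //; apply: K_refl.
by move=> a b ab; apply: (id1 _ _ _ Kσ Kτ Kυ).1; apply: t_step.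
Qed.

Lemma id2_incl_eq : id2_incl K A <-> id2_eq K A.
Proof.
split=> id2 σ τ Kσ Kτ.
  split; first by apply: clos_trans_least; apply: id2.
  apply: clos_trans_mono => a b [ab ab'].
  by split=> //; exists b; split=> //; apply: K_refl.
by move=> a b ab; apply: (id2 _ _ Kσ Kτ).1; apply: t_step.
Qed.

Lemma id3_eq_id3_eq_closed : id3_eq K A -> id3_eq_closed K A.
Proof.
move=> id3 σ τ Kσ Kτ; have [s1 s2] := id3 _ _ Kσ Kτ.
by split; [apply: clos_trans_least | move=> a b /s2; apply: t_step].
Qed.

Lemma id3_eq_closed_id2 : id3_eq_closed K A -> id2_incl K A.
Proof.
move=> id3 σ τ Kσ Kτ a c [ac [b [ab bc]]].
apply: (id3 _ _ Kσ Kτ).1; apply: t_step; split; first exact: t_step.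
by apply: (t_trans _ _ _ b); apply: t_step.
Qed.

Lemma id1_equiv :
  (forall R : relation A, refl_admissible R -> K R) ->
  (id1_incl K A <-> id1_incl (@refl_admissible S) A).
Proof.
move=> RK; split=> [id1 σ τ υ σA τA υA|/id1_incl_localize id1 σ τ υ σK τK υK].
  by apply: id1; apply: RK.
by apply: id1; apply: KU.
Qed.

Hypothesis U2K : forall R : relation A, U2_admissible R -> K R.

Lemma id2_id1 : id2_incl K A -> id1_incl (@refl_admissible S) A.
Proof. by move=> id2; apply: id2_U2_id1 => σ τ /U2K σK /U2K τK; apply: id2. Qed.

Lemma id1_id3 : id1_incl (@refl_admissible S) A -> id3_eq K A.
Proof.
by move=> /id1_incl_localize/id1_U_id3 id3 σ τ /KU σU /KU τU; apply: id3.
Qed.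

End OneKind.

Lemma all_conditions_equiv (c : condition S) :
  In c (all_conditions S) -> (c A <-> id1_incl (@refl_admissible S) A).
Proof.
have RU2 := @refl_admissible_U2 S A.
have U2U := @U2_admissible_U S A.
have RU R (RA : refl_admissible R) := U2U R (RU2 R RA).
pose six (K : relation_kind S) :=
  [:: id1_incl K; id1_eq K; id2_incl K; id2_eq K; id3_eq K; id3_eq_closed K].
have K6 (K : relation_kind S) (KU : forall R : relation A, K A R -> U_admissible R)
    (U2K : forall R : relation A, U2_admissible R -> K A R) c' :
    In c' (six K) -> (c' A <-> id1_incl (@refl_admissible S) A).
  have e1 := id1_equiv KU (fun R RA => U2K R (RU2 R RA)).
  have e1' := id1_incl_eq KU; have e2 := id2_incl_eq KU.
  have i13 := id1_id3 KU; have i21 := id2_id1 U2K.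
  have i33 := @id3_eq_id3_eq_closed K; have i32 := @id3_eq_closed_id2 K.
  by move=> /=; do !case=> [<-|]; tauto.
have -> : all_conditions S = six (@U_admissible S) ++ six (@U2_admissible S) ++
    [:: id1_incl (@refl_admissible S); id1_eq (@refl_admissible S)] by [].
move=> /(in_app_or _ _ _)[|/(in_app_or _ _ _)[|]]; [exact: K6 | exact: K6 | ].
by have e1 := id1_incl_eq RU; move=> /=; do !case=> [<-|]; tauto.
Qed.

End OneAlgebra.

(** * From the free algebra to the variety *)

Lemma id1_transfer (S : signature) (V : algebra S -> Prop) (F : algebra S)
    (x : 'I_3 -> F) (A : algebra S) :
  is_free V x -> V A ->
  id1_incl (@refl_admissible S) F -> id1_incl (@refl_admissible S) A.
Proof.
move=> [_ free] VA id1 σ τ υ σA τA υA a c [ac [b [ab bc]]].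
have [h [[hh hx] _]] := free A (fun i => seq.nth a [:: a; b; c] i) VA.
have h0 : h (x (inord 0)) = a by rewrite hx inordK.
have h1 : h (x (inord 1)) = b by rewrite hx inordK.
have h2 : h (x (inord 2)) = c by rewrite hx inordK.
pose pre (R : relation A) : relation F := fun u v => R (h u) (h v).
have preA R : refl_admissible R -> refl_admissible (pre R).
  exact: refl_admissible_preim hh.
rewrite -h0 -h2.
have : (pre σ ⊓ pre τ ∘ pre σ ⊓ pre υ)^⊛ (x (inord 0)) (x (inord 2)).
  apply: id1; [exact: preA.. |].
  by split; [|exists (x (inord 1)); split]; rewrite /pre ?h0 ?h1 ?h2.
apply: (clos_trans_image (h := h)) => u w [v [uv vw]].
by exists (h v).
Qed.

Theorem theorem3p6 (S : signature) (V : algebra S -> Prop) (hV : is_variety V)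
    (F : algebra S) (x : 'I_3 -> F) (hF : is_free V x) :
  (forall c d : condition S,
      In c (all_conditions S) -> In d (all_conditions S) ->
      (valid_in V c <-> valid_in V d)) /\
  (forall c : condition S,
      In c (all_conditions S) -> (valid_in V c <-> c F)).
Proof.
have transfer c : In c (all_conditions S) -> (valid_in V c <-> c F).
  move=> cI; split=> [cV|cF A VA]; first by apply: cV; case: hF.
  apply/(all_conditions_equiv A cI); apply: (id1_transfer hF VA).
  exact/(all_conditions_equiv F cI).
split=> // c d cI dI.
rewrite (transfer c cI) (transfer d dI).
by rewrite (all_conditions_equiv F cI) (all_conditions_equiv F dI).
Qed.
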